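(* Let $a,b\in\mathbb Z$ and let $m$ be a positive integer. Define $w_0=a$, $w_1=b$, $w_n=w_{n-1}+w_{n-2}$ for $n\ge 2$. Then the sequence $(w_n)$ reduced modulo $m$ is residue complete (i.e. for every $x\in\mathbb Z_m$ there is $n\ge 0$ with $w_n\equiv x \pmod m$) if and only if $$m\in\mathcal F=\{5^k,\ 2\cdot 5^k,\ 4\cdot 5^k,\ 3^j5^k,\ 6\cdot 5^k,\ 7\cdot 5^k,\ 14\cdot 5^k \,:\, k\ge 0,\ j\ge 1\}$$ and $\gcd(m,\, b^2-ab-a^2)=1$.
   Context: For fixed integers $a,b$, the sequence $w_n=w_n(a,b)$ is defined by $w_0=a$, $w_1=b$, $w_n=w_{n-1}+w_{n-2}$. Modulo $m$ this sequence is periodic; a period of it modulo $m$ is called a Fibonacci cycle modulo $m$ and denoted $w(a,b,m)$. The cycle $w(a,b,m)$ is called residue complete if every residue class $x\in\mathbb Z_m$ occurs among its terms (equivalently, among the $w_n \bmod m$). *)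

(* Defs.v *)
From mathcomp Require Import all_boot all_order all_algebra.
Set Implicit Arguments.
Unset Strict Implicit.
Unset Printing Implicit Defensive.
Import Order.TTheory GRing.Theory Num.Theory.
Local Open Scope ring_scope.

Fixpoint wseq (a b : int) (n : nat) {struct n} : int :=
  match n with
  | 0%N => a
  | 1%N => b
  | (k.+1 as k').+1 => wseq a b k' + wseq a b k
  end.

(* Residue classes modulo m are given by integer representatives x. This avoids
   'Z_m, which is Z/2 rather than the trivial ring when m = 1. *)
Definition residue_complete (a b : int) (m : nat) : Prop :=
  forall x : int, exists n : nat, (wseq a b n = x %[mod m%:Z])%Z.

Definition famF (m : nat) : Prop :=
  exists k : nat,
       m = (5 ^ k)%N
    \/ m = (2 * 5 ^ k)%N
    \/ m = (4 * 5 ^ k)%N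
    \/ (exists j : nat, (1 <= j)%N /\ m = (3 ^ j * 5 ^ k)%N)
    \/ m = (6 * 5 ^ k)%N
    \/ m = (7 * 5 ^ k)%N
    \/ m = (14 * 5 ^ k)%N.

(* Main.v *)
(* The norm w_(n+1)^2 - w_n w_(n+1) - w_n^2 is invariant up to sign. If w is
   complete modulo m it has a zero, and a prime dividing both m and the norm
   would then divide all the terms; so from that zero on w is a unit multiple of
   the Fibonacci sequence F, and F is complete modulo every divisor of m. The
   moduli 8, 12, 18, 21, 28, 49 and the primes p > 7 are impossible:
   - if 5 is a square mod p, F has period p - 1 and F_1 = F_2;
   - if 5 is not a square and p = 1 mod 4, put h = (p + 1) / 2: then F_h = 0 and
     F_(n+h) = g F_n with g^2 = -1, so the nonzero values of F fill fewer than
     (p - 1) / 4 classes modulo the fourth roots of unity;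
   - if 5 is not a square and p = 3 mod 4, a value x of F makes 5 x^2 + 4 or
     5 x^2 - 4 a square, which three consecutive non-residues v - 1, v, v + 1
     contradict at 5 x^2 = 4 v; such a v comes from one of the progressions
     -2, 1, 4; 1, 2, 3; -6, 1, 8.
   Conversely, for q = 3 or 5 dividing m, completeness lifts from m to q m:
   if A^T = 1 + m B for the companion matrix A, the terms w_(n + iT), i < q, are
   congruent to w_n modulo m and run through its q lifts modulo q m. *)
Require Import Defs.
From mathcomp Require Import all_boot all_order all_algebra finfield.
From mathcomp Require Import zify ring.
Set Implicit Arguments.
Unset Strict Implicit.
Unset Printing Implicit Defensive.
Import GRing.Theory.
Local Open Scope ring_scope.

(** * Addition formula, norm, and sequences with a zero modulo m *)

Local Notation fib := (wseq 0 1).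
Local Notation wnorm a b := (b ^+ 2 - a * b - a ^+ 2).

(** Splits a goal into a known equation [z = t] and an identity left to [ring]. *)
Lemma eq_of_subr (V : zmodType) (x y z t : V) : z = t -> x - y = z - t -> x = y.
Proof. by move=> ->; rewrite subrr => /eqP; rewrite subr_eq0 => /eqP. Qed.

Lemma wseqSS (a b : int) n : wseq a b n.+2 = wseq a b n.+1 + wseq a b n.
Proof. by []. Qed.

(** The coefficient [fib k.+1 - fib k] is F_(k-1), in a form that makes sense at k = 0. *)
Lemma wseqD (a b : int) n k :
  wseq a b (n + k) = fib k * wseq a b n.+1 + (fib k.+1 - fib k) * wseq a b n.
Proof.
suff [] : wseq a b (n + k) = fib k * wseq a b n.+1 +
             (fib k.+1 - fib k) * wseq a b n /\
          wseq a b (n + k.+1) = fib k.+1 * wseq a b n.+1 +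
             fib k * wseq a b n by [].
elim: k => [|k [IH1 IH2]]; first by rewrite addn0 addn1 /=; split; ring.
split; first by rewrite IH2 wseqSS; ring.
by rewrite !addnS wseqSS -addnS IH1 IH2 wseqSS; ring.
Qed.

Lemma wseq_norm (a b : int) n :
  wnorm (wseq a b n) (wseq a b n.+1) = (-1) ^+ n * wnorm a b.
Proof.
elim: n => [|n IH]; first by rewrite /= mul1r.
by rewrite [(-1) ^+ _]exprS -mulrA -IH wseqSS; ring.
Qed.

Lemma coprimez_wseq_norm d a b n :
  coprimez d (wnorm (wseq a b n) (wseq a b n.+1)) = coprimez d (wnorm a b).
Proof.
rewrite wseq_norm coprimezMr; suff -> : coprimez d ((-1) ^+ n) by [].
by rewrite -signr_odd; case: (odd n); rewrite /coprimez /= ?gcdzN ?gcdz1.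
Qed.

Lemma residue_completeP (a b : int) m :
  residue_complete a b m <->
  forall x, exists n, (m%:Z %| wseq a b n - x)%Z.
Proof.
split=> H x; have [n Hn] := H x; exists n.
  by rewrite -eqz_mod_dvd Hn.
by apply/eqP; rewrite eqz_mod_dvd.
Qed.

Lemma residue_complete_dvd (a b : int) d m :
  (d %| m)%N -> residue_complete a b m -> residue_complete a b d.
Proof.
move=> dm /residue_completeP H; apply/residue_completeP => x.
have [n Hn] := H x; exists n; exact: dvdz_trans Hn.
Qed.

Lemma wseq_zero_mul (a b : int) (m : int) n k :
  (m %| wseq a b n)%Z -> (m %| wseq a b (n + k) - wseq a b n.+1 * fib k)%Z.
Proof.
case/dvdzP=> z Hz; rewrite wseqD Hz; apply/dvdzP.
by exists ((fib k.+1 - fib k) * z); ring.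
Qed.

(** At a zero modulo m the norm reduces to w_(n+1)^2, so a Bezout relation for the norm yields one
    for w_(n+1). *)
Lemma coprimez_wseq_zero (a b : int) (m : int) n :
  coprimez m (wnorm a b) -> (m %| wseq a b n)%Z -> coprimez m (wseq a b n.+1).
Proof.
rewrite -(coprimez_wseq_norm _ _ _ n) => /coprimezP [[u v] /= uv].
case/dvdzP=> z Hz; apply/coprimezP.
exists (u - v * (z * wseq a b n.+1 + z ^+ 2 * m), v * wseq a b n.+1) => /=.
by rewrite -uv Hz; ring.
Qed.

Lemma wseq_zeroM (a b : int) (m : int) n k i :
  (m %| wseq a b n)%Z -> (m %| fib k)%Z -> (m %| wseq a b (n + i * k))%Z.
Proof.
move=> mn mk; elim: i => [|i IH]; first by rewrite addn0.
rewrite mulSn addnCA addnC wseqD.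
by apply: rpredD; [exact: dvdz_mulr | exact: dvdz_mull].
Qed.

Lemma wseq_zero_fib (a b m : int) n :
  coprimez m (wnorm a b) -> (m %| wseq a b n)%Z ->
  exists v, forall k x,
    (m %| fib k - v * x)%Z -> (m %| wseq a b (n + k) - x)%Z.
Proof.
move=> cN mn; have /coprimezP [[u v] /= uv] := coprimez_wseq_zero cN mn.
(* [v] is the inverse of w_(n+1) modulo m, and w_(n+k) is congruent to w_(n+1) F_k. *)
exists v => k x /dvdzP [z Hz]; have /dvdzP [y Hy] := wseq_zero_mul k mn.
apply/dvdzP; exists (y + wseq a b n.+1 * z - u * x).
have -> : wseq a b (n + k) = y * m + wseq a b n.+1 * fib k by rewrite -Hy; ring.
have -> : fib k = z * m + v * x by rewrite -Hz; ring.
by rewrite -[X in _ - X]mul1r -uv; ring.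
Qed.

Lemma residue_complete_zero (a b : int) (m : nat) n :
  coprimez m%:Z (wnorm a b) -> (m%:Z %| wseq a b n)%Z ->
  residue_complete 0 1 m -> residue_complete a b m.
Proof.
move=> cN mn /residue_completeP H; apply/residue_completeP => x.
have [v Hv] := wseq_zero_fib cN mn; have [k hk] := H (v * x).
by exists (n + k)%N; apply: Hv.
Qed.

(** * Lifting completeness from m to q m for q = 3 and q = 5 *)

(* In terms of the companion matrix A of the recurrence:
   A ^ T = 1 + m (s A + t), with T even. *)
Definition fib_shift (m : int) (T : nat) (s t : int) :=
  [/\ ~~ odd T, fib T = m * s & fib T.+1 = fib T + 1 + m * t].

(** With B = s A + t, the determinant of 1 + m B is 1 + m tr B + m^2 det B. It equals 1 as T is
    even, so m divides tr B = s + 2 t. *)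
Lemma fib_shift_trace m T s t :
  m != 0 -> fib_shift m T s t -> (m %| s + 2 * t)%Z.
Proof.
move=> m0 [ev Xs Yt]; apply/dvdzP; exists (s ^+ 2 - s * t - t ^+ 2).
have := wseq_norm 0 1 T; rewrite -signr_odd (negbTE ev) expr0 Yt Xs => E.
by apply: (mulfI m0); apply: (eq_of_subr E); ring.
Qed.

Lemma fib_shiftE m T s t a b n :
  fib_shift m T s t ->
  wseq a b (n + T) = wseq a b n + m * (s * wseq a b n.+1 + t * wseq a b n).
Proof. by case=> _ Xs Yt; rewrite wseqD Yt Xs; ring. Qed.

Lemma fib_shift_iter m T s t a b n i :
  fib_shift m T s t ->
  (m %| wseq a b (n + i * T) - wseq a b n)%Z /\
  (m ^+ 2 %| wseq a b (n + i * T) - wseq a b n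
             - i%:Z * m * (s * wseq a b n.+1 + t * wseq a b n))%Z.
Proof.
(* The increment also involves w_(n+1), so its congruence modulo m joins the induction. *)
move=> sh; suff H k : (m %| wseq a b (n + k * T) - wseq a b n)%Z /\
    (m %| wseq a b (n + k * T).+1 - wseq a b n.+1)%Z /\
    (m ^+ 2 %| wseq a b (n + k * T) - wseq a b n
             - k%:Z * m * (s * wseq a b n.+1 + t * wseq a b n))%Z.
  by have [H1 [_ H2]] := H i.
elim: k => [|k [/dvdzP [x Hx] [/dvdzP [y Hy] /dvdzP [z Hz]]]].
  by rewrite mul0n addn0 !subrr mul0r mul0r subr0 !dvdz0.
rewrite mulSn (addnC T) addnA -addSn !(fib_shiftE _ _ _ sh) wseqSS.
move/eqP: Hx; rewrite subr_eq => /eqP Hx.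
move/eqP: Hy; rewrite subr_eq => /eqP Hy.
rewrite Hx Hy in Hz *; split; [|split]; apply/dvdzP.
- by exists (x + (s * (y * m + wseq a b n.+1) + t * (x * m + wseq a b n))); ring.
- exists (y + s * (y * m + wseq a b n.+1 + (x * m + wseq a b n)) +
          t * (y * m + wseq a b n.+1)); ring.
exists (z + (s * y + t * x)); apply: (eq_of_subr Hz); rewrite intS; ring.
Qed.

(** Modulo m^2, hence modulo q m, each shift by T adds m u. With w_n - x = z m, it remains to solve
    z + i u = 0 modulo q. *)
Lemma wseq_lift m T s t a b n (q : int) x :
  q != 0 -> fib_shift m T s t -> (q %| m)%Z ->
  coprimez q (s * wseq a b n.+1 + t * wseq a b n) ->
  (m %| wseq a b n - x)%Z ->
  exists i, (q * m %| wseq a b (n + i * T) - x)%Z.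
Proof.
set u := _ + _ => q0 sh /dvdzP [r Hr] /coprimezP [[c d] /= cd] /dvdzP [z Hz].
have [i /dvdzP [y Hy]] : exists i : nat, (q %| z + i%:Z * u)%Z.
  (* [d] inverts u modulo q; the remainder makes i a natural number. *)
  exists `|((- z * d) %% q)%Z|%N; rewrite gez0_abs ?modz_ge0 //.
  apply/dvdzP; exists (z * c - (- z * d %/ q)%Z * u).
  rewrite /modz -[X in X + _](mulr1 z) -cd; ring.
exists i; have [_ /dvdzP [k Hk]] := fib_shift_iter a b n i sh.
apply/dvdzP; exists (y + k * r).
have -> : wseq a b (n + i * T) - x = k * m ^+ 2 + m * (z + i%:Z * u).
  by apply: (eq_of_subr Hk); rewrite -/u -[wseq a b n](subrK x) Hz; ring.
by rewrite Hy expr2 {1}Hr; ring.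
Qed.

Lemma dvdz_prime_sq (p : nat) (x : int) : prime p -> (p%:Z %| x ^+ 2)%Z = (p%:Z %| x)%Z.
Proof. by move=> pp; rewrite !dvdzE abszX Euclid_dvdX // andbT. Qed.

Lemma dvdz_primeM (p : nat) (x y : int) :
  prime p -> (p%:Z %| x * y)%Z = (p%:Z %| x)%Z || (p%:Z %| y)%Z.
Proof. by move=> pp; rewrite !dvdzE abszM Euclid_dvdM. Qed.

Lemma coprimez_prime (p : nat) (x : int) :
  prime p -> coprimez p%:Z x = ~~ (p%:Z %| x)%Z.
Proof. by move=> pp; rewrite coprimezE prime_coprime // dvdzE. Qed.

(** By the trace s = -2 t modulo 5, and (x - 2 y)^2 = 4 (y^2 - x y - x^2) modulo 5: the square of
    the increment is 4 t^2 times the norm. *)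
Lemma lift5_unit (m : int) T s t (a b : int) n :
  m != 0 -> fib_shift m T s t -> (5%:Z %| m)%Z -> ~~ (5%:Z %| t)%Z ->
  coprimez 5%:Z (wnorm a b) ->
  coprimez 5%:Z (s * wseq a b n.+1 + t * wseq a b n).
Proof.
move=> m0 sh d5 t5 N5.
have /dvdzP [z Hz] := dvdz_trans d5 (fib_shift_trace m0 sh).
rewrite -(coprimez_wseq_norm _ _ _ n) in N5.
move: (wseq a b n) (wseq a b n.+1) N5 => x y N5.
rewrite (coprimez_prime) // -(dvdz_prime_sq) //.
have -> : s = z * 5 - 2 * t by rewrite -Hz; ring.
have -> : ((z * 5 - 2 * t) * y + t * x) ^+ 2 =
   5 * (z * y * (5 * z * y + 2 * (t * x - 2 * t * y)) + t ^+ 2 * x ^+ 2) +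
   2 ^+ 2 * (t ^+ 2 * wnorm x y) by ring.
rewrite rpredDl; last exact: dvdz_mulr.
rewrite !(dvdz_primeM _ _ (isT : prime 5)) (negbTE t5) /=.
by rewrite coprimez_prime in N5.
Qed.

(** By the trace s = -2 t = t modulo 3, so the increment is t w_(n+2) modulo 3. *)
Lemma lift3_unit (m : int) T s t (a b : int) n :
  m != 0 -> fib_shift m T s t -> (3%:Z %| m)%Z -> ~~ (3%:Z %| t)%Z ->
  ~~ (3%:Z %| wseq a b n.+2)%Z ->
  coprimez 3%:Z (s * wseq a b n.+1 + t * wseq a b n).
Proof.
move=> m0 sh d3 t3; rewrite wseqSS => w3.
have /dvdzP [z Hz] := dvdz_trans d3 (fib_shift_trace m0 sh).
move: (wseq a b n) (wseq a b n.+1) w3 => x y w3.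
rewrite (coprimez_prime) //.
have -> : s = z * 3 - 2 * t by rewrite -Hz; ring.
have -> : ((z * 3 - 2 * t) * y + t * x) = 3 * (z * y - t * y) + t * (y + x) by ring.
rewrite rpredDl; last exact: dvdz_mulr.
by rewrite (dvdz_primeM _ _) // (negbTE t3) (negbTE w3).
Qed.

Definition fib_pair T (z : int * int) := fib T = z.1 /\ fib T.+1 = z.1 + z.2.

(* Product in Z[x]/(x^2 - x - 1), where (s, t) stands for s x + t. *)
Definition gmul (u v : int * int) : int * int :=
  (u.1 * v.1 + u.1 * v.2 + u.2 * v.1, u.1 * v.1 + u.2 * v.2).

Lemma fib_pairD T1 T2 u v :
  fib_pair T1 u -> fib_pair T2 v -> fib_pair (T1 + T2) (gmul u v).
Proof.
case=> X1 Y1 [X2 Y2]; split.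
  by rewrite wseqD Y1 X1 Y2 X2 /=; ring.
by rewrite -addSn wseqD wseqSS Y1 X1 Y2 X2 /=; ring.
Qed.

(** Cube 1 + m B with B = s A + t. As 3 | m, the term m^3 B^3 is a multiple of 3 m too, and the new
    B agrees with the old one modulo m. *)
Lemma fib_shift3 (m : int) T s t :
  fib_shift m T s t -> (3%:Z %| m)%Z ->
  exists s' t', fib_shift (3 * m) (3 * T) s' t' /\ (m %| t' - t)%Z.
Proof.
move=> [ev X1 Y1] /dvdzP [r Hr].
have P1 : fib_pair T (m * s, 1 + m * t) by split; rewrite ?Y1 X1 //=; ring.
have P2 := fib_pairD P1 P1; have [X3 Y3] := fib_pairD P1 P2.
pose B2 := gmul (s, t) (s, t); pose B3 := gmul (s, t) B2.
exists (s + m * B2.1 + m * r * B3.1), (t + m * B2.2 + m * r * B3.2); split; last first.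
  by apply/dvdzP; exists (B2.2 + r * B3.2); ring.
have -> : (3 * T = T + (T + T))%N by lia.
split; first by rewrite !oddD (negbTE ev).
  by rewrite X3 /B3 /B2 /= Hr; ring.
by rewrite Y3 X3 /B3 /B2 /= Hr; ring.
Qed.

Lemma fib_shift5 (m : int) T s t :
  fib_shift m T s t -> (5%:Z %| m)%Z ->
  exists s' t', fib_shift (5 * m) (5 * T) s' t' /\ (m %| t' - t)%Z.
Proof.
move=> [ev X1 Y1] /dvdzP [r Hr].
have P1 : fib_pair T (m * s, 1 + m * t) by split; rewrite ?Y1 X1 //=; ring.
have P2 := fib_pairD P1 P1; have P4 := fib_pairD P2 P2.
have [X5 Y5] := fib_pairD P1 P4.
pose B2 := gmul (s, t) (s, t); pose B3 := gmul (s, t) B2.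
pose B4 := gmul (s, t) B3; pose B5 := gmul (s, t) B4.
(* One coordinate of ((1 + m B)^5 - 1) / (5 m), where m = 5 r. *)
pose f (y y2 y3 y4 y5 : int) :=
  y + m * (2 * y2 + 2 * m * y3 + m ^+ 2 * y4 + m ^+ 2 * r * y5).
exists (f s B2.1 B3.1 B4.1 B5.1), (f t B2.2 B3.2 B4.2 B5.2); split; last first.
  rewrite /f; apply/dvdzP; eexists; rewrite addrAC subrr add0r mulrC; reflexivity.
have -> : (5 * T = T + (T + T + (T + T)))%N by lia.
split; first by rewrite !oddD (negbTE ev).
  by rewrite X5 /f /B5 /B4 /B3 /B2 /= Hr; ring.
by rewrite Y5 X5 /f /B5 /B4 /B3 /B2 /= Hr; ring.
Qed.

(* Residue completeness modulo m strengthened so that it lifts to 3 m: only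
   terms with w_(n+2) prime to 3 can be lifted. *)
Definition complete3 (a b : int) (m : nat) :=
  forall x, exists2 n, (m%:Z %| wseq a b n - x)%Z & ~~ (3%:Z %| wseq a b n.+2)%Z.

(** When q | m, the condition on t says that A^T is not 1 modulo q m: by the trace, q | t would
    force q | s. *)
Definition liftable (q m : nat) :=
  exists T s t, fib_shift m%:Z T s t /\ ~~ (q%:Z %| t)%Z.

Lemma dvdz_congr (d x y : int) : (d %| x - y)%Z -> (d %| x)%Z = (d %| y)%Z.
Proof. by move=> h; rewrite -(subrK y x) rpredDl. Qed.

Lemma complete3_lift (a b : int) (m : nat) :
  (0 < m)%N -> (3 %| m)%N -> liftable 3 m ->
  complete3 a b m -> complete3 a b (3 * m).
Proof.
move=> m0 d3 [T [s [t [sh t3]]]] H x; have [n Hn wn] := H x.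
have m0' : m%:Z != 0 by rewrite eqz_nat -lt0n.
have d3' : (3%:Z %| m%:Z)%Z by rewrite dvdzE.
have u3 := lift3_unit m0' sh d3' t3 wn.
have [//|i Hi] := wseq_lift _ sh d3' u3 Hn.
exists (n + i * T)%N; rewrite ?PoszM //.
(* Shifts by T fix all terms modulo m, hence modulo 3, so the side condition survives the lift. *)
have [h _] := fib_shift_iter a b n.+2 i sh.
by rewrite -!addSn (dvdz_congr (dvdz_trans d3' h)).
Qed.

Lemma residue_complete_lift5 (a b : int) (m : nat) :
  (0 < m)%N -> (5 %| m)%N -> liftable 5 m -> coprimez 5%:Z (wnorm a b) ->
  residue_complete a b m -> residue_complete a b (5 * m).
Proof.
move=> m0 d5 [T [s [t [sh t5]]]] N5 /residue_completeP H.
apply/residue_completeP => x; have [n Hn] := H x.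
have m0' : m%:Z != 0 by rewrite eqz_nat -lt0n.
have d5' : (5%:Z %| m%:Z)%Z by rewrite dvdzE.
have u5 := lift5_unit n m0' sh d5' t5 N5.
have [//|i Hi] := wseq_lift _ sh d5' u5 Hn.
by exists (n + i * T)%N; rewrite ?PoszM.
Qed.

Lemma liftable_step3 (q m : nat) :
  (q %| m)%N -> (3 %| m)%N -> liftable q m -> liftable q (3 * m).
Proof.
move=> dq d3 [T [s [t [sh tq]]]].
have [|s' [t' [sh' tt']]] := fib_shift3 sh; first by rewrite dvdzE.
exists (3 * T)%N, s', t'; rewrite PoszM; split=> //.
by rewrite (dvdz_congr (dvdz_trans _ tt')) // dvdzE.
Qed.

Lemma liftable_step5 (q m : nat) :
  (q %| m)%N -> (5 %| m)%N -> liftable q m -> liftable q (5 * m).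
Proof.
move=> dq d5 [T [s [t [sh tq]]]].
have [|s' [t' [sh' tt']]] := fib_shift5 sh; first by rewrite dvdzE.
exists (5 * T)%N, s', t'; rewrite PoszM; split=> //.
by rewrite (dvdz_congr (dvdz_trans _ tt')) // dvdzE.
Qed.

(** * Finite checks by iterating the recurrence modulo m *)

Lemma residue_nat (m : nat) (c : int) :
  (0 < m)%N -> exists2 x, (x < m)%N & (m%:Z %| c - x%:Z)%Z.
Proof.
move=> m0; have m0' : m%:Z != 0 by rewrite eqz_nat -lt0n.
exists `|(c %% m%:Z)%Z|%N; last by rewrite gez0_abs ?modz_ge0 // -eqz_mod_dvd modz_mod.
by rewrite -ltz_nat gez0_abs ?modz_ge0 // ltz_pmod.
Qed.

Definition fstep (m : nat) (z : nat * nat) : nat * nat := (z.2, (z.1 + z.2) %% m)%N.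

Lemma wseq_fstep (a b : int) (m : nat) z n :
  (m%:Z %| a - z.1%:Z)%Z -> (m%:Z %| b - z.2%:Z)%Z ->
  (m%:Z %| wseq a b n - (iter n (fstep m) z).1%:Z)%Z /\
  (m%:Z %| wseq a b n.+1 - (iter n (fstep m) z).2%:Z)%Z.
Proof.
move=> ha hb; elim: n => [//|n [IH1 IH2]]; split; first by [].
rewrite wseqSS iterS /=; move: (iter n _ _) IH1 IH2 => [x y] /= IH1 IH2.
rewrite -modz_nat -eqz_mod_dvd modz_mod PoszD eqz_mod_dvd.
have -> : wseq a b n.+1 + wseq a b n - (x%:Z + y%:Z) =
  (wseq a b n.+1 - y%:Z) + (wseq a b n - x%:Z) by ring.
exact: rpredD.
Qed.

Lemma fib_fstep (m n : nat) :
  (m%:Z %| fib n - (iter n (fstep m) (0, 1)%N).1%:Z)%Z /\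
  (m%:Z %| fib n.+1 - (iter n (fstep m) (0, 1)%N).2%:Z)%Z.
Proof. by apply: wseq_fstep; rewrite ?subrr. Qed.

(** [m.-1] stands for -1, so that the coprimality test is on the norm of (x, y). *)
Definition has_zeros (m alpha : nat) : bool :=
  all (fun x => all (fun y =>
      coprime m ((y ^ 2 + m.-1 * (x * y + x ^ 2)) %% m) ==>
      has (fun z => z.1 == 0)%N (traject (fstep m) (x, y) alpha))
    (iota 0 m)) (iota 0 m).

Lemma has_zerosP (m alpha : nat) (a b : int) :
  has_zeros m alpha -> (0 < m)%N -> coprimez m%:Z (wnorm a b) ->
  exists n, (m%:Z %| wseq a b n)%Z.
Proof.
move=> /allP H m0 cN.
have [x xm ha] := residue_nat a m0; have [y ym hb] := residue_nat b m0.
have xI : x \in iota 0 m by rewrite mem_iota.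
have yI : y \in iota 0 m by rewrite mem_iota.
have /allP/(_ y yI)/implyP Hxy := H x xI.
have [|z /trajectP [n _ ->] /eqP z0] := hasP (Hxy _).
  rewrite coprime_modr; move: cN.
  rewrite -[coprime _ _]/(coprimez m%:Z (y ^ 2 + m.-1 * (x * y + x ^ 2))%N%:Z).
  have/dvdzP [u Hu] := ha; have/dvdzP [v Hv] := hb.
  rewrite -[a](subrK x%:Z) -[b](subrK y%:Z) Hu Hv => /coprimezP [[c d] /= cd].
  apply/coprimezP => /=.
  (* The factor of [d] is the difference between the norm of (a, b) and the natural number tested,
     divided by m. *)
  exists (c + d * (v ^+ 2 * m%:Z + 2 * v * y%:Z - u * v * m%:Z - u * y%:Z - v * x%:Z
          - u ^+ 2 * m%:Z - 2 * u * x%:Z - x%:Z * y%:Z - x%:Z ^+ 2), d) => /=.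
  have mE : m.-1%:Z = m%:Z - 1 by rewrite -[in RHS](prednK m0) intS; ring.
  by rewrite -[RHS]cd -!mulnn PoszD (PoszM m.-1) PoszD !PoszM mE; ring.
exists n; have [h _] := wseq_fstep (z := (x, y)) n ha hb.
by move: h; rewrite z0 subr0.
Qed.

(** Zeros modulo m1 recur with step k1 and zeros modulo m2 with step k2; the Chinese remainder
    theorem on indices gives a common one. *)
Lemma zeros_crt (a b : int) (m1 m2 k1 k2 n1 n2 : nat) :
  coprime m1 m2 -> coprime k1 k2 -> (0 < k1)%N -> (0 < k2)%N ->
  (m1%:Z %| wseq a b n1)%Z -> (m1%:Z %| fib k1)%Z ->
  (m2%:Z %| wseq a b n2)%Z -> (m2%:Z %| fib k2)%Z ->
  exists n, ((m1 * m2)%:Z %| wseq a b n)%Z.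
Proof.
move=> cm ck k1_gt0 k2_gt0 w1 f1 w2 f2.
(* The added multiple of k1 k2 puts n beyond n1 and n2, making the subtractions exact. *)
pose n := (chinese k1 k2 n1 n2 + (n1 + n2) * (k1 * k2))%N; exists n.
have [le1 le2] : (n1 <= n)%N /\ (n2 <= n)%N.
  have : (n1 + n2 <= (n1 + n2) * (k1 * k2))%N by rewrite leq_pmulr ?muln_gt0 ?k1_gt0.
  rewrite /n; lia.
have /dvdnP [i Hi] : (k1 %| n - n1)%N.
  rewrite -eqn_mod_dvd // /n mulnCA -modnDm modnMr addn0 modn_mod.
  by rewrite chinese_modl.
have /dvdnP [j Hj] : (k2 %| n - n2)%N.
  rewrite -eqn_mod_dvd // /n mulnA -modnDm modnMl addn0 modn_mod.
  by rewrite chinese_modr.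
rewrite PoszM Gauss_dvdz ?coprimezE //; apply/andP; split.
  by rewrite -(subnKC le1) Hi; apply: wseq_zeroM.
by rewrite -(subnKC le2) Hj; apply: wseq_zeroM.
Qed.

Lemma fib_dvdP (m k : nat) :
  (iter k (fstep m) (0, 1)%N).1 = 0%N -> (m%:Z %| fib k)%Z.
Proof. by move=> z0; have [h _] := fib_fstep m k; move: h; rewrite z0 subr0. Qed.

(** As F_5 = 5, zeros modulo 5 recur with step 5, prime to alpha. This spares a search over pairs
    modulo 5 m. *)
Lemma has_zeros_mul5 (m alpha : nat) (a b : int) :
  has_zeros m alpha -> (0 < m)%N -> (0 < alpha)%N ->
  coprime m 5 -> coprime alpha 5 ->
  (iter alpha (fstep m) (0, 1)%N).1 = 0%N ->
  coprimez (m * 5)%:Z (wnorm a b) ->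
  exists n, ((m * 5)%:Z %| wseq a b n)%Z.
Proof.
move=> hm m0 alpha0 cm ca fm; rewrite PoszM coprimezMl => /andP [Nm N5].
have [n1 h1] := has_zerosP hm m0 Nm.
have [n2 h2] := has_zerosP (isT : has_zeros 5 5) isT N5.
exact: (zeros_crt cm ca alpha0 isT h1 (fib_dvdP fm) h2 (@fib_dvdP 5 5 erefl)).
Qed.

Definition fib_values (m T : nat) (P : pred (nat * nat)) : bool :=
  all (fun x => has (fun z => (z.1 == x) && P z)%N (traject (fstep m) (0, 1)%N T))
    (iota 0 m).

Lemma fib_valuesP (m T : nat) (P : pred (nat * nat)) (x : int) :
  fib_values m T P -> (0 < m)%N ->
  exists n, (m%:Z %| fib n - x)%Z /\ P (iter n (fstep m) (0, 1)%N).
Proof.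
move=> /allP H m0; have [y ym hx] := residue_nat x m0.
have /H /hasP [z /trajectP [n _ zE] /andP [/eqP zy Pz]] : y \in iota 0 m.
  by rewrite mem_iota.
exists n; rewrite -zE; split=> //; have [h _] := fib_fstep m n.
have -> : fib n - x = (fib n - y%:Z) - (x - y%:Z) by ring.
by apply: rpredB hx; rewrite -zy zE.
Qed.

Lemma fib_values_complete (m T : nat) :
  fib_values m T predT -> (0 < m)%N -> residue_complete 0 1 m.
Proof.
move=> H m0; apply/residue_completeP => x.
by have [n [h _]] := fib_valuesP x H m0; exists n.
Qed.

Lemma fib_values_complete3 (m T : nat) :
  fib_values m T (fun z => ~~ (3 %| z.1 + z.2)%N) -> (0 < m)%N -> (3 %| m)%N ->
  complete3 0 1 m.
Proof.
move=> H m0 d3 x; have [n [h Pn]] := fib_valuesP x H m0; exists n => //.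
rewrite wseqSS; have [h1 h2] := fib_fstep m n.
have d3' : (3%:Z %| m%:Z)%Z by rewrite dvdzE.
move: h1 h2 Pn; move: (iter n _ _) => [u v] /= h1 h2.
apply: contra => w3; rewrite -[(3 %| _)%N]/((3%:Z %| (u + v)%N%:Z)%Z).
rewrite -(dvdz_congr (x := fib n.+1 + fib n)) //; apply: (dvdz_trans d3').
have -> : fib n.+1 + fib n - (u + v)%N%:Z = (fib n - u%:Z) + (fib n.+1 - v%:Z).
  by rewrite PoszD; ring.
exact: rpredD.
Qed.

Lemma complete3_zero (a b : int) (m n : nat) :
  (3 %| m)%N -> coprimez m%:Z (wnorm a b) -> (m%:Z %| wseq a b n)%Z ->
  complete3 0 1 m -> complete3 a b m.
Proof.
move=> d3 cN mn H x; have d3' : (3%:Z %| m%:Z)%Z by rewrite dvdzE.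
have [v Hv] := wseq_zero_fib cN mn; have [k hk k3] := H (v * x).
exists (n + k)%N; first exact: Hv.
have h := dvdz_trans d3' (wseq_zero_mul k.+2 mn).
suff : ~~ (3%:Z %| wseq a b (n + k.+2))%Z by rewrite !addnS.
rewrite (dvdz_congr h) dvdz_primeM // (negbTE k3) orbF -coprimez_prime //.
exact: coprimez_dvdl d3 (coprimez_wseq_zero cN mn).
Qed.

Lemma complete3W (a b : int) m : complete3 a b m -> residue_complete a b m.
Proof. by move=> H; apply/residue_completeP => x; have [n h _] := H x; exists n. Qed.

(** Here z is (F_T, F_(T+1)) modulo q m. If q | t, the trace gives q | s, hence q m | F_T, which the
    last test excludes. *)
Lemma liftableP (q m T : nat) :
  (0 < m)%N -> (q %| m)%N -> ~~ odd T ->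
  (let z := iter T (fstep (q * m)) (0, 1)%N in
   [&& m %| z.1, z.2 == 1 %[mod m] & ~~ (q * m %| z.1)])%N ->
  liftable q m.
Proof.
move=> m0 dq ev; have [] := fib_fstep (q * m) T.
move: (iter T _ _) => [u v] /= h1 h2 /and3P [mu mv nu].
have hm : (m%:Z %| (q * m)%:Z)%Z by rewrite dvdzE dvdn_mull.
have ms : (m%:Z %| fib T)%Z by rewrite (dvdz_congr (dvdz_trans hm h1)).
have mt : (m%:Z %| fib T.+1 - fib T - 1)%Z.
  rewrite addrAC rpredB // -eqz_mod_dvd.
  have /eqP -> : (fib T.+1 == v %[mod m])%Z by rewrite eqz_mod_dvd (dvdz_trans hm h2).
  by rewrite !modz_nat eqz_nat.
have /dvdzP [s Hs] := ms; have /dvdzP [t Ht] := mt.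
have sh : fib_shift m%:Z T s t.
  split=> //; first by rewrite Hs mulrC.
  by apply: (eq_of_subr Ht); ring.
exists T, s, t; split=> //; apply: contra nu => /dvdzP [t' Ht'].
have m0' : m%:Z != 0 by rewrite eqz_nat -lt0n.
have /dvdzP [r Hr] := fib_shift_trace m0' sh.
have /dvdzP [c Hc] : (q%:Z %| m%:Z)%Z by rewrite dvdzE.
rewrite -[(_ %| u)%N]/((q * m)%N%:Z %| u%:Z)%Z -(dvdz_congr h1) Hs PoszM.
apply/dvdzP; exists (r * c - 2 * t').
have -> : s = r * (c * q%:Z) - 2 * (t' * q%:Z) by rewrite -Ht' -Hc -Hr; ring.
ring.
Qed.

(** * Completeness for the moduli of the family *)

Lemma complete_pow5 (a b : int) (m k : nat) :
  (0 < m)%N -> (5 %| m)%N -> liftable 5 m -> coprimez 5%:Z (wnorm a b) ->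
  residue_complete a b m -> residue_complete a b (5 ^ k * m).
Proof.
move=> m0 d5 lm cN cm.
suff [] : liftable 5 (5 ^ k * m) /\ residue_complete a b (5 ^ k * m) by [].
elim: k => [|k [IHl IHc]]; first by rewrite mul1n.
have d5k : (5 %| 5 ^ k * m)%N by rewrite dvdn_mull.
rewrite expnS -mulnA; split; first exact: liftable_step5.
by apply: residue_complete_lift5; rewrite // muln_gt0 expn_gt0 m0.
Qed.

Lemma complete3_pow3 (a b : int) (m j : nat) :
  (0 < m)%N -> (3 %| m)%N -> liftable 3 m -> complete3 a b m ->
  complete3 a b (3 ^ j * m).
Proof.
move=> m0 d3 lm cm.
suff [] : liftable 3 (3 ^ j * m) /\ complete3 a b (3 ^ j * m) by [].
elim: j => [|j [IHl IHc]]; first by rewrite mul1n.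
have d3j : (3 %| 3 ^ j * m)%N by rewrite dvdn_mull.
rewrite expnS -mulnA; split; first exact: liftable_step3.
by apply: complete3_lift; rewrite // muln_gt0 expn_gt0 m0.
Qed.

Lemma liftable_pow3 (q m j : nat) :
  (q %| m)%N -> (3 %| m)%N -> liftable q m -> liftable q (3 ^ j * m).
Proof.
move=> dq d3 lm; elim: j => [|j IH]; first by rewrite mul1n.
by rewrite expnS -mulnA; apply: liftable_step3; rewrite ?dvdn_mull.
Qed.

Lemma complete_base (a b : int) (m alpha T : nat) :
  (0 < m)%N -> has_zeros m alpha -> fib_values m T predT ->
  coprimez m%:Z (wnorm a b) -> residue_complete a b m.
Proof.
move=> m0 hz fv cN; have [n hn] := has_zerosP hz m0 cN.
exact: (residue_complete_zero cN hn (fib_values_complete fv m0)).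
Qed.

(** Lifting by 5 needs 5 | m, so the induction on the exponent starts from the modulus 5 m. *)
Lemma complete_base_pow5 (a b : int) (m alpha T k : nat) :
  (0 < m)%N -> (0 < alpha)%N -> coprime m 5 -> coprime alpha 5 -> ~~ odd T ->
  has_zeros m alpha -> (iter alpha (fstep m) (0, 1)%N).1 = 0%N ->
  fib_values (m * 5) T predT ->
  (let z := iter T (fstep (5 * (m * 5))) (0, 1)%N in
   [&& m * 5 %| z.1, z.2 == 1 %[mod m * 5] & ~~ (5 * (m * 5) %| z.1)])%N ->
  coprimez (m * 5 ^ k.+1)%:Z (wnorm a b) -> residue_complete a b (m * 5 ^ k.+1).
Proof.
move=> m0 al0 cm ca ev hz hr fv hl cN.
have m5 : (0 < m * 5)%N by rewrite muln_gt0 m0.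
have cN5 : coprimez (m * 5)%:Z (wnorm a b).
  by apply: coprimez_dvdl cN; rewrite expnS mulnA dvdn_mulr.
have [n hn] := has_zeros_mul5 hz m0 al0 cm ca hr cN5.
have -> : (m * 5 ^ k.+1 = 5 ^ k * (m * 5))%N by rewrite expnS; lia.
apply: complete_pow5; rewrite ?dvdn_mull //.
- by apply: (liftableP m5 _ ev hl); rewrite dvdn_mull.
- by apply: coprimez_dvdl cN5; rewrite dvdn_mull.
exact: (residue_complete_zero cN5 hn (fib_values_complete fv m5)).
Qed.

(** Powers of 3 come first, from 3 or 15, while [complete3] is available; the lifts by 5 then need
    plain completeness only. The periods modulo 3 and 15 are 8 and 40. *)
Lemma complete_3pow_5pow (a b : int) (j k : nat) :
  coprimez (3 ^ j.+1 * 5 ^ k)%:Z (wnorm a b) ->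
  residue_complete a b (3 ^ j.+1 * 5 ^ k).
Proof.
move=> cN.
have c3 : coprimez 3%:Z (wnorm a b).
  by apply: coprimez_dvdl cN; rewrite expnS -mulnA dvdn_mulr.
have z3 : has_zeros 3 4 by vm_compute.
case: k cN => [_|k cN].
  have [n hn] := has_zerosP z3 isT c3.
  rewrite muln1 expnSr; apply/complete3W/complete3_pow3 => //.
    by apply: (@liftableP _ _ 8) => //; vm_compute.
  apply: (complete3_zero _ c3 hn) => //.
  by apply: (@fib_values_complete3 _ 8) => //; vm_compute.
have c15 : coprimez 15%:Z (wnorm a b).
  apply: coprimez_dvdl cN; rewrite !expnS mulnACA -[15%N]/(3 * 5)%N.
  exact: dvdn_mulr.
have c5 : coprimez 5%:Z (wnorm a b) by apply: coprimez_dvdl c15.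
have [n hn] : exists n, (15%:Z %| wseq a b n)%Z.
  by apply: (has_zeros_mul5 z3).
have -> : (3 ^ j.+1 * 5 ^ k.+1 = 5 ^ k * (3 ^ j * 15))%N by rewrite !expnS; lia.
apply: complete_pow5; rewrite ?muln_gt0 ?expn_gt0 ?dvdn_mull //.
  apply: liftable_pow3 => //.
  by apply: (@liftableP _ _ 40) => //; vm_compute.
apply/complete3W/complete3_pow3 => //.
  by apply: (@liftableP _ _ 40) => //; vm_compute.
apply: (complete3_zero _ c15 hn) => //.
by apply: (@fib_values_complete3 _ 40) => //; vm_compute.
Qed.

Lemma famF_complete (a b : int) (m : nat) :
  famF m -> coprimez m%:Z (wnorm a b) -> residue_complete a b m.
Proof.
have base m0 alpha T0 T k : (0 < m0)%N -> (0 < alpha)%N -> coprime m0 5 ->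
  coprime alpha 5 -> ~~ odd T ->
  has_zeros m0 alpha -> (iter alpha (fstep m0) (0, 1)%N).1 = 0%N ->
  fib_values m0 T0 predT -> fib_values (m0 * 5) T predT ->
  (let z := iter T (fstep (5 * (m0 * 5))) (0, 1)%N in
   [&& m0 * 5 %| z.1, z.2 == 1 %[mod m0 * 5] & ~~ (5 * (m0 * 5) %| z.1)])%N ->
  coprimez (m0 * 5 ^ k)%:Z (wnorm a b) -> residue_complete a b (m0 * 5 ^ k).
  move=> p1 p2 p3 p4 p5 p6 p7 p8 p9 p10; case: k => [|k].
    by rewrite muln1; exact: complete_base p1 p6 p8.
  exact: (complete_base_pow5 p1 p2 p3 p4 p5 p6 p7 p9 p10).
case=> k [->|[->|[->|[[[|j] [//= _ ->]]|[->|[->|->]]]]]].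
(* The arguments are m0, the index of a zero of F modulo m0, and the periods of F modulo m0 and 5
   m0. *)
- by rewrite -[(5 ^ k)%N]mul1n; apply: (base 1 2 1 20)%N; vm_compute.
- by apply: (base 2 3 3 60)%N; vm_compute.
- by apply: (base 4 6 6 60)%N; vm_compute.
- exact: complete_3pow_5pow.
- by apply: (base 6 12 24 120)%N; vm_compute.
- by apply: (base 7 8 16 80)%N; vm_compute.
- by apply: (base 14 24 48 240)%N; vm_compute.
Qed.

(** * Necessity: from w modulo m to F modulo the divisors of m *)

Lemma wseq_zeros (a b d : int) n :
  (d %| wseq a b n)%Z -> (d %| wseq a b n.+1)%Z -> forall k, (d %| wseq a b k)%Z.
Proof.
have zeros k : (d %| a)%Z -> (d %| b)%Z -> (d %| wseq a b k)%Z /\ (d %| wseq a b k.+1)%Z.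
  move=> da db; elim: k => [//|k [IH1 IH2]]; split=> //.
  by rewrite wseqSS; apply: rpredD.
move=> h0 h1 k; suff [da db] : (d %| a)%Z /\ (d %| b)%Z by have [] := zeros k da db.
(* The recurrence run backwards reaches a and b. *)
elim: n h0 h1 => [//|n IH h0]; rewrite wseqSS rpredDl // => h1; exact: IH.
Qed.

Lemma complete_coprime (a b : int) (m : nat) :
  (0 < m)%N -> residue_complete a b m -> coprimez m%:Z (wnorm a b).
Proof.
move=> m0 cm; apply: contraT; rewrite coprimezE /coprime => g1; exfalso.
set g := gcdn _ _ in g1; have g_gt0 : (0 < g)%N by rewrite gcdn_gt0 m0.
have pp : prime (pdiv g) by apply: pdiv_prime; rewrite ltn_neqAle eq_sym g1.
set p := pdiv g in pp.
have pm : (p %| m)%N := dvdn_trans (pdiv_dvd g) (dvdn_gcdl _ _).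
have pN : (p%:Z %| wnorm a b)%Z := dvdn_trans (pdiv_dvd g) (dvdn_gcdr _ _).
have /residue_completeP cp := residue_complete_dvd pm cm.
have [n] := cp 0; rewrite subr0 => h0; have [k] := cp 1.
have h1 : (p%:Z %| wseq a b n.+1)%Z.
  rewrite -dvdz_prime_sq // (dvdz_congr (y := wnorm (wseq a b n) (wseq a b n.+1))).
    by rewrite wseq_norm dvdz_mull.
  have /dvdzP [z ->] := h0; apply/dvdzP.
  by exists (z * (wseq a b n.+1 + z * p%:Z)); ring.
move=> hk; have := rpredB (wseq_zeros h0 h1 k) hk.
by rewrite subKr dvdzE Euclid_dvd1.
Qed.

(** The step on pairs is injective on a finite set, so the orbit of the initial pair is a cycle. *)
Lemma wseq_periodic (a b : int) (m : nat) :
  (0 < m)%N -> exists2 T, (0 < T)%N & forall n, (m%:Z %| wseq a b (n + T) - wseq a b n)%Z.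
Proof.
case: m => [//|m] _.
have [x xm ha] := residue_nat a (ltn0Sn m); have [y ym hb] := residue_nat b (ltn0Sn m).
pose f (z : 'I_m.+1 * 'I_m.+1) := (z.2, z.1 + z.2).
have f_inj : injective f.
  move=> [u v] [u' v'] E; have /= e2 := congr1 fst E.
  by have /= := congr1 snd E; rewrite e2 => /addIr ->.
pose z0 : 'I_m.+1 * 'I_m.+1 := (Ordinal xm, Ordinal ym).
pose val2 (z : 'I_m.+1 * 'I_m.+1) : nat * nat := (val z.1, val z.2).
have f_step k : val2 (iter k f z0) = iter k (fstep m.+1) (x, y).
  by elim: k => [//|k IH]; rewrite !iterS -IH.
exists (order f z0) => [|n]; first exact: order_gt0.
have [h1 _] := wseq_fstep (z := (x, y)) n ha hb.
have [h2 _] := wseq_fstep (z := (x, y)) (n + order f z0) ha hb.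
move: h2; rewrite -f_step iterD (iter_order f_inj) f_step => h2.
by have := rpredB h2 h1; rewrite opprB addrA subrK.
Qed.

Lemma complete_fib (a b : int) (m d : nat) :
  (0 < m)%N -> (d %| m)%N -> residue_complete a b m -> residue_complete 0 1 d.
Proof.
move=> m0 dm cm; have d0 : (0 < d)%N := dvdn_gt0 m0 dm.
have cN := complete_coprime d0 (residue_complete_dvd dm cm).
have /residue_completeP cd := residue_complete_dvd dm cm.
apply/residue_completeP => x.
have [n] := cd 0; rewrite subr0 => h0; have cu := coprimez_wseq_zero cN h0.
have [j hj] := cd (wseq a b n.+1 * x).
have [T T0 per] := wseq_periodic a b d0.
have perM i : (d%:Z %| wseq a b (j + i * T) - wseq a b j)%Z.
  elim: i => [|i IH]; first by rewrite addn0 subrr.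
  have := rpredD (per (j + i * T)%N) IH; rewrite addrA subrK.
  by rewrite mulSn (addnC T) addnA.
(* Periodicity moves the index of the value w_(n+1) x past the zero n, where w is w_(n+1) times
   F. *)
have le : (n <= j + n * T)%N by rewrite (leq_trans _ (leq_addl _ _)) // leq_pmulr.
exists (j + n * T - n)%N; rewrite -(Gauss_dvdzr _ cu) mulrBr.
have := wseq_zero_mul (j + n * T - n) h0; rewrite subnKC // => hk.
have := rpredB (rpredD (perM n) hj) hk.
by congr (_ %| _)%Z; ring.
Qed.

(** * The excluded small moduli *)

Lemma fib_not_complete (d T x : nat) :
  looping (fstep d) (0, 1)%N T ->
  all (fun z => z.1 != x %[mod d])%N (traject (fstep d) (0, 1)%N T) ->
  ~ residue_complete 0 1 d.
Proof.
move=> /loopingP lp /allP H /residue_completeP /(_ x%:Z) [n hn].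
have /negP := H _ (lp n); apply; have [h _] := fib_fstep d n.
rewrite -eqz_nat -!modz_nat eqz_mod_dvd.
by have := rpredB hn h; congr (_ %| _)%Z; ring.
Qed.

Lemma fib_not_complete_small (d : nat) :
  d \in [:: 8; 12; 18; 21; 28; 49]%N -> ~ residue_complete 0 1 d.
Proof.
rewrite !inE => /or4P [|||/or3P []] /eqP ->.
(* The numbers are the period of F modulo d and a class that F misses. *)
- by apply: (@fib_not_complete _ 12 4); vm_compute.
- by apply: (@fib_not_complete _ 24 6); vm_compute.
- by apply: (@fib_not_complete _ 24 4); vm_compute.
- by apply: (@fib_not_complete _ 16 4); vm_compute.
- by apply: (@fib_not_complete _ 48 10); vm_compute.
- by apply: (@fib_not_complete _ 112 4); vm_compute.
Qed.

(** * Primes above 7 *)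

Section FibModPrime.
Variable p : nat.
Hypotheses (p_prime : prime p) (p_gt7 : (7 < p)%N).

Let f n : 'F_p := (fib n)%:~R.
Let k := p.-1./2.
(** The Legendre symbol of 5, by Euler's criterion. *)
Let e : 'F_p := 5 ^+ k.

Let p_odd : odd p.
Proof. by case: (even_prime p_prime) => // p2; move: p_gt7; rewrite p2. Qed.

Let pE : p = k.*2.+1.
Proof. by rewrite /k; have := odd_double_half p; rewrite p_odd; lia. Qed.

Let fSS n : f n.+2 = f n.+1 + f n.
Proof. by rewrite /f wseqSS rmorphD. Qed.

Let fD n j : f (n + j) = f j * f n.+1 + (f j.+1 - f j) * f n.
Proof. by rewrite /f wseqD rmorphD !rmorphM rmorphB. Qed.

Let f_norm n : f n.+1 ^+ 2 - f n * f n.+1 - f n ^+ 2 = (-1) ^+ n.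
Proof.
rewrite /f -!rmorphXn -rmorphM -!rmorphB wseq_norm rmorphM rmorph_sign.
by rewrite expr1n mul0r expr0n !subr0 mulr1.
Qed.

Let natF_neq0 q : (0 < q < p)%N -> q%:R != 0 :> 'F_p.
Proof.
case/andP=> q0 qp; rewrite -(dvdn_pcharf (pchar_Fp p_prime)).
by rewrite gtnNdvd.
Qed.

Let expfp1 (x : 'F_p) : x != 0 -> x ^+ k.*2 = 1.
Proof.
move=> x0; apply: (mulfI x0); rewrite -exprS -pE mulr1.
by have := expf_card x; rewrite card_Fp.
Qed.

Let five_neq0 : 5%:R != 0 :> 'F_p. Proof. by apply: natF_neq0; lia. Qed.
Let two_neq0 : 2%:R != 0 :> 'F_p. Proof. by apply: natF_neq0; lia. Qed.

Let one_neqN1 : 1 != -1 :> 'F_p.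
Proof. by rewrite -subr_eq0 opprK. Qed.

Let e_sign : e = 1 \/ e = -1.
Proof.
have /eqP : e ^+ 2 = 1 by rewrite -exprM muln2 expfp1.
by rewrite sqrf_eq1 => /orP [] /eqP; [left|right].
Qed.

Let A : 'M['F_p]_2 := \matrix_(i, j) (if (i == 0) && (j == 0) then 0 else 1).

Let A_sq : A ^+ 2 = A + 1.
Proof.
apply/matrixP => i j; rewrite expr2 -mulmxE !mxE !big_ord_recl big_ord0 !mxE.
by case: i j => [[|[|//]] ?] [[|[|//]] ?] /=; ring.
Qed.

Let A_exp n : A ^+ n = f n *: A + (f n.+1 - f n)%:A.
Proof.
elim: n => [|n IH]; first by rewrite expr0 scale0r add0r subr0 scale1r.
rewrite exprS IH mulrDr -!scalerAr -expr2 A_sq mulr1 fSS.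
by rewrite scalerDr addrAC -scalerDl; congr (_ *: _ + _ *: _); ring.
Qed.

(* Frobenius applied to 2 A - 1, whose square is 5. *)
Let fib_p : f p = e /\ 2 * f p.+1 = 1 + e.
Proof.
have cM : p \in [char 'M['F_p]_2] by rewrite pchar_lalg pchar_Fp.
pose B : 'M['F_p]_2 := 2%:R *: A - 1.
have B_sq : B ^+ 2 = 5%:R *: 1.
  apply/matrixP => i j; rewrite expr2 -mulmxE !mxE !big_ord_recl big_ord0 !mxE.
  by case: i j => [[|[|//]] ?] [[|[|//]] ?] /=; ring.
have Bp : B ^+ p = e *: B.
  have -> : B ^+ p = B ^+ k.*2.+1 by congr (_ ^+ _).
  by rewrite exprS -muln2 mulnC exprM B_sq exprZn expr1n -scalerAr mulr1.
have : B ^+ p = 2%:R *: A ^+ p - 1.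
  rewrite -!(pFrobenius_autE cM) pFrobenius_autB_comm; last exact: commr1.
  rewrite pFrobenius_aut1 !scaler_nat pFrobenius_autMn //.
rewrite Bp A_exp => /matrixP E; have := E 0 1; have := E 0 0.
rewrite !mxE /= => E00 E01; have fpe : f p = e.
  by apply: (mulfI two_neq0); apply: (eq_of_subr (esym E01)); ring.
split=> //; apply: (eq_of_subr (esym E00)); rewrite fpe; ring.
Qed.

Hypothesis f_surj : forall x, exists n, f n = x.

Let leq_values (s : seq 'F_p) : (forall n, f n \in s) -> (p <= size s)%N.
Proof.
move=> fs; rewrite -{1}(card_Fp p_prime) cardE; apply: uniq_leq_size (enum_uniq _) _.
by move=> x _; have [n <-] := f_surj x.
Qed.

Let split_case : e <> 1.
Proof.
move=> e1; have [fp fp1] := fib_p.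
have {}fp1 : f p.+1 = 1 by apply: (mulfI two_neq0); rewrite fp1 e1 mulr1.
have f0 : f p.-1 = 0.
  have := fSS p.-1; rewrite prednK ?prime_gt0 // fp1 fp e1 => E.
  by apply: (eq_of_subr (esym E)); ring.
have per n i : f (n + i * p.-1) = f n.
  elim: i => [|i IH]; first by rewrite addn0.
  rewrite mulSn addnCA addnC fD f0 prednK ?prime_gt0 // fp e1 IH; ring.
(* One period without the index 1, as F_1 = F_2: p - 2 entries. *)
have := leq_values (s := [seq f n | n <- 0%N :: iota 2 (p - 3)]).
rewrite size_map /= size_iota; suff H n : f n \in [seq f n | n <- 0%N :: iota 2 (p - 3)].
  by move/(_ H); lia.
rewrite (divn_eq n p.-1) addnC per.
have : (n %% p.-1 < p.-1)%N by rewrite ltn_mod; lia.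
case: (n %% p.-1)%N => [_|[_|r hr]]; first by apply: map_f; rewrite inE.
  by rewrite -[f 1]/(f 2); apply: map_f; rewrite inE mem_iota; lia.
by apply: map_f; rewrite inE mem_iota; lia.
Qed.

Let inert_3mod4 : e = -1 -> odd k -> False.
Proof.
move=> e1 ok.
pose chi (x : 'F_p) := x ^+ k.
have chiM x y : chi (x * y) = chi x * chi y by rewrite /chi exprMn.
have chiV x : chi x^-1 = (chi x)^-1 by rewrite /chi exprVn.
have chiN1 : chi (-1) = -1 by rewrite /chi -signr_odd ok.
have chi_sign x : x != 0 -> chi x = 1 \/ chi x = -1.
  move=> x0; have /eqP : chi x ^+ 2 = 1 by rewrite /chi -exprM muln2 expfp1.
  by rewrite sqrf_eq1 => /orP [] /eqP; [left|right].
have chi_sq x : x != 0 -> chi (x ^+ 2) = 1.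
  by move=> x0; rewrite /chi -exprM mul2n expfp1.
have chi4 : chi 4%:R = 1.
  have -> : 4%:R = 2%:R ^+ 2 :> 'F_p by ring.
  exact: chi_sq.
have k0 : (0 < k)%N by case: (k) ok.
suff [v [v0 v1 v2]] : exists v, [/\ chi (v - 1) = -1, chi v = -1 & chi (v + 1) = -1].
  (* 4 v / 5 is a quotient of non-residues, hence a square; as p = 3 mod 4, its power (k + 1) / 2 is
     a square root. *)
  pose x := (4%:R * v / 5%:R) ^+ (k./2).+1.
  have x_sq : 5%:R * x ^+ 2 = 4%:R * v.
    rewrite /x -exprM muln2 doubleS -[X in _ ^+ X.+2](addKn 1%N) subn1.
    have -> : ((1 + (k./2).*2).-1.+2 = k.+1)%N by have := odd_double_half k; rewrite ok; lia.
    rewrite exprS -/(chi _) !chiM chiV chi4 v1 [chi 5%:R]e1 invrN1 mul1r mulN1r opprK mulr1.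
    by rewrite mulrC divfK.
  have [n fn] := f_surj x; have := f_norm n; rewrite fn; set y := f n.+1 => yE.
  (* (2 y - x)^2 is 5 x^2 plus four times the norm, which is 1 or -1. *)
  have sqE : (2%:R * y - x) ^+ 2 = 4%:R * (v + (-1) ^+ n).
    by rewrite -yE mulrDr -x_sq; ring.
  have chin : chi (v + (-1) ^+ n) = -1 by rewrite -signr_odd; case: (odd n).
  have : chi ((2%:R * y - x) ^+ 2) = -1 by rewrite sqE chiM chi4 chin mul1r.
  have [->|nz] := eqVneq (2%:R * y - x) 0.
    rewrite /chi expr2 mul0r expr0n eqn0Ngt k0 => /eqP.
    by rewrite eq_sym oppr_eq0 oner_eq0.
  by rewrite chi_sq // => /eqP; rewrite (negbTE one_neqN1).
(* Three consecutive residues become non-residues by negation, as chi(-1) = -1. *)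
suff [r [r1 r0 r2]] : exists r, [/\ chi (r - 1) = chi r, r != 0 & chi (r + 1) = chi r].
  have [cr|cr] := chi_sign r r0; last by exists r; rewrite r1 r2 cr.
  exists (- r); have -> : - r - 1 = -1 * (r + 1) by ring.
  have -> : - r + 1 = -1 * (r - 1) by ring.
  by rewrite -[- r]mulN1r !chiM chiN1 r1 r2 cr mulr1.
have three_neq0 : 3%:R != 0 :> 'F_p by apply: natF_neq0; lia.
have seven_neq0 : 7%:R != 0 :> 'F_p by apply: natF_neq0; lia.
(* Use -2, 1, 4 over 3 if chi(2) = -1; 1, 2, 3 if chi(2) = chi(3) = 1; -6, 1, 8 over 7 otherwise. *)
have [c2|c2] := chi_sign _ two_neq0; last first.
  exists (3%:R^-1); split; last 1 first.
  - have -> : 3%:R^-1 + 1 = 4%:R * 3%:R^-1 :> 'F_p by field.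
    by rewrite chiM chi4 mul1r.
  - have -> : 3%:R^-1 - 1 = -1 * (2%:R * 3%:R^-1) :> 'F_p by field.
    by rewrite !chiM chiN1 c2; ring.
  by rewrite invr_eq0.
have [c3|c3] := chi_sign _ three_neq0.
  exists 2%:R; split; rewrite ?two_neq0 // c2.
    have -> : 2%:R - 1 = 1 :> 'F_p by ring.
    by rewrite /chi expr1n.
  by have -> : 2%:R + 1 = 3%:R :> 'F_p by ring.
exists (7%:R^-1); split; last 1 first.
- have -> : 7%:R^-1 + 1 = 4%:R * (2%:R * 7%:R^-1) :> 'F_p by field.
  by rewrite !chiM chi4 c2 !mul1r.
- have -> : 7%:R^-1 - 1 = -1 * (2%:R * (3%:R * 7%:R^-1)) :> 'F_p by field.
  by rewrite !chiM chiN1 c2 c3; ring.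
by rewrite invr_eq0.
Qed.

Let inert_1mod4 : e = -1 -> ~~ odd k -> False.
Proof.
move=> e1 ek; have [fp fp1] := fib_p; pose h := k.+1.
have {}fp1 : f (h + h) = 0.
  have -> : (h + h = p.+1)%N by rewrite /h [in RHS]pE; lia.
  by apply: (mulfI two_neq0); rewrite fp1 e1 mulr0 subrr.
have kE : k = k./2.*2 by have := odd_double_half k; rewrite (negbTE ek).
have nh : f h.+1 ^+ 2 - f h * f h.+1 - f h ^+ 2 = -1.
  by rewrite f_norm -signr_odd /h /= ek.
(* otherwise L_h = 0, where L_h ^ 2 - 5 f_h ^ 2 = -4, and 5 is a square *)
have fh : f h = 0.
  apply/eqP/negPn/negP => fh0.
  have L0 : 2%:R * f h.+1 - f h = 0.
    by apply: (mulfI fh0); rewrite mulr0 -fp1 fD; ring.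
  have five : 5%:R = (2%:R / f h) ^+ 2 :> 'F_p.
    have E : 5%:R * f h ^+ 2 = 4%:R.
      have L2 : (2%:R * f h.+1 - f h) ^+ 2 = 0 by rewrite L0 expr2 mul0r.
      have L3 : (2%:R * f h.+1 - f h) ^+ 2 = 5%:R * f h ^+ 2 + 4%:R * -1.
        by rewrite -nh; ring.
      by apply: (eq_of_subr (etrans (esym L3) L2)); ring.
    by rewrite expr_div_n -[2%:R ^+ 2]natrX -[(2 ^ 2)%N]/4%N -E mulfK // expf_neq0.
  have : e = 1.
    rewrite /e five -exprM mul2n expfp1 // mulf_neq0 ?invr_eq0 //.
  by rewrite e1 => /eqP; rewrite eq_sym (negbTE one_neqN1).
pose g := f h.+1; have g2 : g * g = -1 by rewrite -nh fh; ring.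
have per n : f (n + h) = g * f n by rewrite fD fh; ring.
(* The addition formulas for F_h = 0 and F_(h+1) = g are linear in F_(h-n) and F_(h-n+1);
   eliminating the latter leaves the norm as coefficient. *)
have refl n : (n <= h)%N -> f (h - n) = - (-1) ^+ n * g * f n.
  move=> nh'; have E0 : f (h - n + n) = 0 by rewrite subnK.
  have E1 : f ((h - n).+1 + n) = g by rewrite addSn subnK.
  rewrite fD in E0; rewrite fD fSS in E1.
  have E : (-1) ^+ n * f (h - n) = - (g * f n).
    rewrite -(f_norm n) -E1.
    by apply: (eq_of_subr (congr1 (fun z => f n.+1 * z) E0)); ring.
  by rewrite -(signrMK n (f (h - n))) E; ring.
pose C := [:: 1; g; -1; - g].
(* Reflection folds the indices below h onto 1, ..., k/2, and F_1 = F_2 drops 1. The size is 1 + 4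
   (k/2 - 1) = p - 4. *)
pose s := 0 :: [seq c * f n | c <- C, n <- iota 2 (k./2).-1].
have : (p <= size s)%N.
  apply: leq_values => n; have s0 : 0 \in s by rewrite inE eqxx.
  have sI c r : c \in C -> (1 < r <= k./2)%N -> c * f r \in s.
    move=> cC hr; rewrite inE; apply/orP; right; apply/allpairsP.
    by exists (c, r); split=> //=; rewrite mem_iota; lia.
  have sg x : x \in s -> g * x \in s.
    rewrite inE => /orP [/eqP ->|/allpairsP [[c r] /= [cC hr ->]]]; first by rewrite mulr0.
    rewrite mulrA; apply: sI; last by rewrite mem_iota in hr; lia.
    move: cC; rewrite !inE => /or4P [] /eqP ->;
      by rewrite ?mulr1 ?mulrN ?mulr1 ?g2 ?opprK eqxx ?orbT.
  have sN x : x \in s -> - x \in s.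
    by move=> xs; rewrite -mulN1r -g2 -mulrA !sg.
  have ssign j x : x \in s -> (-1) ^+ j * x \in s.
    by move=> xs; rewrite -signr_odd; case: odd; rewrite ?mul1r ?mulN1r ?sN.
  have small r : (0 < r <= k./2)%N -> f r \in s.
    case: r => [//|[|r]] hr; last by rewrite -[f _]mul1r; apply: sI; rewrite ?inE ?eqxx.
    rewrite -[f 1]/(f 2) -[f 2]mul1r; apply: sI; rewrite ?inE ?eqxx //; lia.
  have low r : (r < h)%N -> f r \in s.
    move=> rh; have [r0|r0] := posnP r; first by rewrite r0.
    have [rk|rk] := leqP r k./2; first by apply: small; rewrite r0.
    have le : (r <= h)%N by apply: ltnW.
    rewrite -(subKn le) refl ?leq_subr // !mulNr -mulrA; apply/sN/ssign/sg/small.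
    rewrite /h in rh *; lia.
  rewrite (divn_eq n h) addnC; elim: (n %/ h)%N => [|q IH].
    by rewrite addn0 low // ltn_mod.
  by rewrite mulSn addnCA addnC per sg.
rewrite /s -cat1s size_cat size_allpairs size_iota /=; have := pE; lia.
Qed.

Lemma fib_not_surj : False.
Proof.
case: e_sign; first exact: split_case.
by move=> e1; case: (boolP (odd k)); [exact: inert_3mod4 | exact: inert_1mod4].
Qed.
End FibModPrime.

Lemma fib_not_complete_prime (p : nat) :
  prime p -> (7 < p)%N -> ~ residue_complete 0 1 p.
Proof.
move=> pp p7 /residue_completeP H; apply: (fib_not_surj pp p7) => x.
have [n] := H (nat_of_ord x)%:Z; rewrite (dvdz_pcharf (pchar_Fp pp)) rmorphB subr_eq0.
by move/eqP=> E; exists n; apply: etrans E _; exact: natr_Zp.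
Qed.

(** * Factorisation of m *)

Lemma famF_of_complete (m : nat) :
  (0 < m)%N -> (forall d, (d %| m)%N -> residue_complete 0 1 d) -> famF m.
Proof.
move=> m0 cm.
have [m5 c5 mE] := pfactor_coprime (isT : prime 5) m0; move: (logn 5 m) mE => k mE.
have m5_gt0 : (0 < m5)%N by move: m0; rewrite mE muln_gt0 => /andP [].
have [m3 c3 m3E] := pfactor_coprime (isT : prime 3) m5_gt0.
move: (logn 3 m5) m3E => j m3E.
have m3_gt0 : (0 < m3)%N by move: m5_gt0; rewrite m3E muln_gt0 => /andP [].
have [m2 c2 m2E] := pfactor_coprime (isT : prime 2) m3_gt0.
move: (logn 2 m3) m2E => i m2E.
have m2_gt0 : (0 < m2)%N by move: m3_gt0; rewrite m2E muln_gt0 => /andP [].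
have [m7 c7 m7E] := pfactor_coprime (isT : prime 7) m2_gt0.
move: (logn 7 m2) m7E => l m7E.
have {}mE : m = (m7 * 7 ^ l * 2 ^ i * 3 ^ j * 5 ^ k)%N by rewrite -m7E -m2E -m3E.
(* A prime factor of [m7] is none of 2, 3, 5, 7, so it exceeds 7. *)
have m7_1 : m7 = 1%N.
  apply/eqP/negPn/negP => m71; have pp : prime (pdiv m7).
    apply: pdiv_prime; rewrite ltn_neqAle eq_sym m71 /=.
    by move: m2_gt0; rewrite m7E muln_gt0 => /andP [].
  have dv := pdiv_dvd m7; move: (pdiv m7) pp dv => p pp dv.
  have pm : (p %| m)%N by rewrite mE -!mulnA dvdn_mulr.
  have := fib_not_complete_prime pp; case: ltnP => [_ /(_ isT) []|p7 _]; first exact: cm.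
  have d2 : (p %| m2)%N by rewrite m7E dvdn_mulr.
  have d3 : (p %| m3)%N by rewrite m2E dvdn_mulr.
  have d5 : (p %| m5)%N by rewrite m3E dvdn_mulr.
  have ncop q n : coprime q n -> (q %| n)%N -> (1 < q)%N -> False.
    by move=> /eqP cq /gcdn_idPl <-; rewrite cq.
  move: pp p7 dv d2 d3 d5; do 8?[case: p pm => [|p] pm //];
    move=> _ _ dv d2 d3 d5; first exact: ncop c2 d2 isT.
  - exact: ncop c3 d3 isT.
  - exact: ncop c5 d5 isT.
  exact: ncop c7 dv isT.
rewrite m7_1 mul1n in mE.
(* Each excluded modulus constrains the exponents i, j, l of 2, 3, 7; what survives is the
   family. *)
have bad d : d \in [:: 8; 12; 18; 21; 28; 49]%N -> ~~ (d %| m)%N.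
  by move=> /fib_not_complete_small H; apply/negP => /cm.
have dvd_m l' i' j' : (l' <= l)%N -> (i' <= i)%N -> (j' <= j)%N ->
    (7 ^ l' * 2 ^ i' * 3 ^ j' %| m)%N.
  by move=> hl hi hj; rewrite mE dvdn_mulr // !dvdn_mul ?dvdn_exp2l.
have h8 : (i < 3)%N.
  by rewrite ltnNge; apply: contra (bad 8 isT) => h; apply: (dvd_m 0 3 0)%N.
have h49 : (l < 2)%N.
  by rewrite ltnNge; apply: contra (bad 49 isT) => h; apply: (dvd_m 2 0 0)%N.
have h12 : ~~ ((1 < i) && (0 < j))%N.
  by apply: contra (bad 12 isT) => /andP [h h']; apply: (dvd_m 0 2 1)%N.
have h18 : ~~ ((0 < i) && (1 < j))%N.
  by apply: contra (bad 18 isT) => /andP [h h']; apply: (dvd_m 0 1 2)%N.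
have h21 : ~~ ((0 < l) && (0 < j))%N.
  by apply: contra (bad 21 isT) => /andP [h h']; apply: (dvd_m 1 0 1)%N.
have h28 : ~~ ((0 < l) && (1 < i))%N.
  by apply: contra (bad 28 isT) => /andP [h h']; apply: (dvd_m 1 2 0)%N.
exists k; rewrite mE; clear -h8 h49 h12 h18 h21 h28.
case: i h8 h12 h18 h28 => [|[|[|//]]] _; case: l h49 h21 => [|[|//]] _;
  case: j => [|[|j]] //= *; rewrite ?expn0 ?expn1 ?mul1n ?muln1; try by tauto.
- by do 3 right; left; exists 1%N.
by do 3 right; left; exists j.+2.
Qed.

Unset Implicit Arguments.

Theorem theorem2p5 (a b : int) (m : nat) (m_gt0 : (0 < m)%N) :
  residue_complete a b m <->
  famF m /\ gcdz m%:Z (b ^+ 2 - a * b - a ^+ 2) = 1.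
Proof.
split=> [cm | [Fm /eqP cN]]; last exact: famF_complete.
split; last exact/eqP/complete_coprime.
by apply: famF_of_complete => // d dm; apply: complete_fib cm.
Qed.
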